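(* Let $q\in(0,1)$ and let $m\geqslant 2$ be an integer. Then for all $x\in[0,1]$ and all $k\in\mathbb{N}_0=\{0,1,2,\dots\}$, $$p_{mk}(q;x)\leqslant p_k(q^m;x).$$
   Context: For $q\in(0,1)$ and $a\in\mathbb{C}$, write $(a;q)_0:=1$, $(a;q)_k:=\prod_{s=0}^{k-1}(1-aq^s)$ for $k\geqslant 1$, and $(a;q)_\infty:=\prod_{s=0}^{\infty}(1-aq^s)$. For $q\in(0,1)$, $k\in\mathbb{N}_0$ and $x\in[0,1]$, $$p_k(q;x):=\frac{x^k\,(x;q)_\infty}{(q;q)_k},$$ with $x^0=1$ (also at $x=0$). In particular $p_k(q^m;x)=\dfrac{x^k (x;q^m)_\infty}{(q^m;q^m)_k}$. *)

(* Defs.v *)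
From mathcomp Require Import all_boot all_order all_algebra.
From mathcomp Require Import all_classical all_reals all_analysis.

Set Implicit Arguments.
Unset Strict Implicit.
Unset Printing Implicit Defensive.

Import Order.TTheory GRing.Theory Num.Theory.
Import numFieldNormedType.Exports.

Local Open Scope classical_set_scope.
Local Open Scope ring_scope.

(* (a; q)_k *)
Definition qpoch (K : numFieldType) (a q : K) (k : nat) : K :=
  \prod_(0 <= s < k) (1 - a * q ^+ s).

(* (a; q)_oo; [lim] returns an unspecified value on divergent sequences, but
   the partial products are nonincreasing and nonnegative for real
   0 <= a <= 1 and 0 < q < 1, so that the limit exists there. *)
Definition qpoch_inf (K : numFieldType) (a q : K) : K :=
  lim (qpoch a q k @[k --> \oo]).

(* p_k(q; x); [x ^+ 0] is 1, also at x = 0. *)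
Definition qp (R : realType) (k : nat) (q x : R) : R :=
  x ^+ k * qpoch_inf x q / qpoch q q k.

(* Main.v *)
Require Import Defs.
From mathcomp Require Import all_boot all_order all_algebra.
From mathcomp Require Import all_classical all_reals all_analysis.
From mathcomp Require Import ring lra.

(* Put Q = q^m and let c(a) = sum of a^j over j >= 1 not divisible by m.  Then
   (x;q)_oo = (x;Q)_oo exp(- sum_i c(q^i) x^i / i), and similarly for
   (q;q)_{mk}.  Multiplying the logarithm of the claim by
   kappa = m ln(1/q) / (m - 1) turns it into
     P(1) <= ln x ln y + P(x) + P(y),   y = Q^k,   P(x) = sum_i w_i x^i / i^2,
   with w_i = kappa i c(q^i).  For w_i = 1 this is Euler's reflection formula
   for the dilogarithm on the curve x + y = 1.

   All that is used of w is w >= 0, w_1 < 1 and w_(i+j) <= w_i w_j; the latter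
   follows from coth s >= 1/s and the monotonicity of n coth(n s) in n.
   Let Z = sum_i w_i x^(i-1), L = x P', so L' = Z, and X = exp(-L).
   Submultiplicativity gives Z' <= Z^2, hence Z exp(-L) <= 1, i.e. X(x) + x is
   nondecreasing.  For fixed y the right-hand side is minimal at the x = s with
   X(s) = y.  Along the curve (s, X(s)) its derivative in s has the sign of
   X(X(s)) - s, which by the monotonicity of X(x) + x agrees with that of
   X(s) - s.  So the value on the part X(s) <= s of the curve is at least the
   value at s = 1, which is at least P(1); the other part follows from the
   symmetry in x and y. *)

Import Order.TTheory GRing.Theory Num.Theory.
Import numFieldNormedType.Exports.

Local Open Scope classical_set_scope.
Local Open Scope ring_scope.

(** * Power series with geometrically decaying coefficients *)

Lemma ger0_is_derive_le {R : realType} (f df : R -> R) (a b : R) :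
  a <= b -> (forall x, a <= x <= b -> is_derive x 1 f (df x)) ->
  (forall x, a <= x <= b -> 0 <= df x) -> f a <= f b.
Proof.
move=> ab fdf df0.
have cf : {within `[a, b], continuous f}.
  apply: derivable_within_continuous => x.
  by rewrite in_itv/= => /fdf[].
have dfo x : x \in `]a, b[ -> is_derive x 1 f (df x).
  by move=> /subset_itv_oo_cc; rewrite in_itv/=; exact: fdf.
have [c cab E] := MVT_segment ab dfo cf.
by rewrite -subr_ge0 E mulr_ge0 ?subr_ge0// df0.
Qed.

Lemma ler0_is_derive_le {R : realType} (f df : R -> R) (a b : R) :
  a <= b -> (forall x, a <= x <= b -> is_derive x 1 f (df x)) ->
  (forall x, a <= x <= b -> df x <= 0) -> f b <= f a.
Proof.
move=> ab fdf df0; rewrite -lerN2.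
apply: (@ger0_is_derive_le R (- f) (fun x => - df x)) => // x xab.
- by have := fdf x xab; move=> ?; apply: is_deriveN.
- by rewrite oppr_ge0 df0.
Qed.

(** The radius of convergence exceeds 1, so the endpoint x = 1 is an interior point and two-sided
    derivatives exist on all of [-1, 1]. *)
Definition geo_decay {R : realType} (c : nat -> R) :=
  exists M r : R, [/\ 0 <= M, 0 <= r, r < 1 & forall n, `|c n| <= M * r ^+ n].

Lemma geo_decay_diffs {R : realType} (c : nat -> R) :
  geo_decay c -> geo_decay (pseries_diffs c).
Proof.
move=> [M [r [M0 r0 r1 cM]]].
pose s := (1 + r) / 2.
have s0 : 0 < s by rewrite /s; lra.
have rs : r < s by rewrite /s; lra.
exists (M * r * (s / (s - r))), s; split; [|exact: ltW|by rewrite /s; lra|].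
  by rewrite !mulr_ge0 // ?invr_ge0; lra.
move=> n; rewrite /pseries_diffs normrM ger0_norm //.
(* Raising the ratio from r to s absorbs the factor n + 1: (n + 1) r^n (s - r) <= s^(n+1), by
   induction with r s^(n+1) + s^(n+1) (s - r) = s^(n+2). *)
have H : n.+1%:R * r ^+ n <= s / (s - r) * s ^+ n.
  rewrite mulrAC ler_pdivlMr ?subr_gt0 // -exprS.
  elim: n => [|n IH]; first by rewrite expr0 expr1 mulr1 mul1r; lra.
  have IH' := ler_wpM2l r0 IH.
  have rs' : r ^+ n.+1 <= s ^+ n.+1 by rewrite lerXn2r ?nnegrE// ltW.
  have {}rs' := ler_wpM2r (_ : 0 <= s - r) rs'.
  have {}rs' := rs' ltac:(lra).
  have -> : n.+2%:R * r ^+ n.+1 * (s - r) =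
      r * (n.+1%:R * r ^+ n * (s - r)) + r ^+ n.+1 * (s - r).
    by rewrite -natr1 exprS; ring.
  by rewrite (le_trans (lerD IH' rs'))// [leRHS]exprS; lra.
rewrite (le_trans (ler_wpM2l _ (cM n.+1))) //.
rewrite exprS -[leRHS]mulrA.
have : 0 <= M * r by rewrite mulr_ge0.
by move: H; move: (n.+1%:R) (r ^+ n) (_ * s ^+ n) => u v w; nra.
Qed.

Lemma geo_decay_cvg {R : realType} (c : nat -> R) (M r x : R) :
  0 <= M -> 0 <= r -> (forall n, `|c n| <= M * r ^+ n) -> `|x| * r < 1 ->
  cvgn (pseries c x).
Proof.
move=> M0 r0 cM xr; apply: normed_cvg.
apply: (@series_le_cvg _ _ (geometric M (`|x| * r))).
- by move=> n /=.
- by move=> n /=; rewrite mulr_ge0 // exprn_ge0 // mulr_ge0.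
- by move=> n /=; rewrite normrM normrX exprMn mulrCA mulrC ler_wpM2l // exprn_ge0.
- by apply: is_cvg_geometric_series; rewrite normrM normr_id (ger0_norm r0).
Qed.

Definition psum {R : realType} (c : nat -> R) (x : R) : R := limn (pseries c x).

Lemma is_derive_psum {R : realType} (c : nat -> R) (x : R) :
  geo_decay c -> `|x| <= 1 ->
  is_derive x 1 (psum c) (psum (pseries_diffs c) x).
Proof.
move=> c0 x1.
have c1 := geo_decay_diffs _ c0; have c2 := geo_decay_diffs _ c1.
have large d : geo_decay d ->
    exists2 K : R, 1 < K & forall y, `|y| <= K -> cvgn (pseries d y).
  (* Any K > 1 with K r < 1 would serve; this choice also covers r = 0. *)
  move=> [M [r [M0 r0 r1 dM]]]; exists (2 / (1 + r)).
    by rewrite ltr_pdivlMr; lra.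
  move=> y yK; apply: geo_decay_cvg dM _ => //.
  rewrite (le_lt_trans (ler_wpM2r r0 yK))// mulrAC ltr_pdivrMr; lra.
have [[K0 K01 P0] [K1 K11 P1] [K2 K21 P2]] :=
  And3 (large _ c0) (large _ c1) (large _ c2).
pose K := Num.min K0 (Num.min K1 K2).
have K1' : 1 < K by rewrite !lt_min K01 K11.
have Kn : `|K| = K by rewrite ger0_norm; lra.
apply: (@pseries_snd_diffs R c K x); rewrite ?Kn.
- by apply: P0; rewrite Kn !ge_min lexx.
- by apply: P1; rewrite Kn !ge_min lexx orbT.
- by apply: P2; rewrite Kn !ge_min lexx !orbT.
- exact: le_lt_trans K1'.
Qed.

Lemma geo_decay_cvg1 {R : realType} (c : nat -> R) (x : R) :
  geo_decay c -> `|x| <= 1 -> cvgn (pseries c x).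
Proof.
move=> [M [r [M0 r0 r1 cM]]] x1; apply: geo_decay_cvg cM _ => //.
by rewrite (le_lt_trans _ r1)// ler_piMl.
Qed.

Lemma psum_ge0 {R : realType} (c : nat -> R) (x : R) :
  geo_decay c -> (forall n, 0 <= c n) -> 0 <= x <= 1 -> 0 <= psum c x.
Proof.
move=> cg c0 /andP[x0 x1]; apply: limr_ge.
  by apply: geo_decay_cvg1; rewrite ?ger0_norm.
by apply: nearW => n; apply: sumr_ge0 => i _; rewrite mulr_ge0 ?exprn_ge0.
Qed.

Lemma geo_decay_shift {R : realType} (c : nat -> R) :
  geo_decay c -> geo_decay (fun n => c n.+1).
Proof.
move=> [M [r [M0 r0 r1 cM]]]; exists (M * r), r; split=> // [|n].
  exact: mulr_ge0.
by rewrite -mulrA -exprS cM.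
Qed.

Lemma psum_shift {R : realType} (c : nat -> R) (x : R) :
  geo_decay c -> `|x| <= 1 ->
  psum c x = c 0%N + x * psum (fun n => c n.+1) x.
Proof.
move=> cg x1.
have c1 := geo_decay_shift _ cg.
have cc := geo_decay_cvg1 _ _ cg x1; have cc1 := geo_decay_cvg1 _ _ c1 x1.
apply: cvg_lim => //; rewrite -cvg_shiftS.
rewrite [X in X @ _](_ : _ =
    (fun n => c 0%N + x * pseries (fun n => c n.+1) x n)); last first.
  apply/funext => n; rewrite /pseries /series /=.
  rewrite big_nat_recl //= expr0 mulr1; congr (_ + _).
  rewrite mulr_sumr; apply: eq_bigr => i _; rewrite exprS; ring.
by apply: cvgD; [exact: cvg_cst|apply: cvgM => //; exact: cvg_cst].
Qed.

Lemma psum0 {R : realType} (c : nat -> R) : geo_decay c -> psum c 0 = c 0%N.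
Proof. by move=> cg; rewrite psum_shift ?normr0 ?mul0r ?addr0. Qed.

(** * Dilogarithms with submultiplicative weights *)

(* In the notation of the header, [z n] is w_(n+1). *)
Definition submultiplicative {R : realType} (z : nat -> R) :=
  [/\ forall n, 0 <= z n, z 0%N < 1 & forall i j, z (i + j).+1 <= z i * z j].

(** Coefficients of the antiderivative vanishing at 0, so [psum (log_coef z)] is L. For z constantly
    1 it is - ln (1 - x), hence the name. *)
Definition log_coef {R : realType} (z : nat -> R) (n : nat) : R :=
  if n is n'.+1 then z n' / n%:R else 0.

(** The index shift divides L by x, and the outer [log_coef] integrates again; this yields P, with
    coefficients w_n / n^2. *)
Definition dilog {R : realType} (z : nat -> R) : R -> R :=
  psum (log_coef (fun n => log_coef z n.+1)).

(** From w_(n+1) <= w_1 w_n follows w_n <= w_1^n, and w_1 < 1. *)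
Lemma geo_decay_submultiplicative {R : realType} (z : nat -> R) :
  submultiplicative z -> geo_decay z.
Proof.
move=> [z0 z1 zM]; exists 1, (z 0%N); split=> // n.
rewrite mul1r ger0_norm//.
suff H : z n <= z 0%N ^+ n.+1.
  by rewrite (le_trans H)// exprS ler_piMl ?exprn_ge0// ltW.
elim: n => [|n IH]; first by rewrite expr1.
by rewrite exprS (le_trans (zM 0%N n))// ler_wpM2l.
Qed.

Lemma log_coef_ge0 {R : realType} (z : nat -> R) :
  (forall n, 0 <= z n) -> forall n, 0 <= log_coef z n.
Proof. by move=> z0 [|n] //=; rewrite divr_ge0. Qed.

Lemma geo_decay_log_coef {R : realType} (z : nat -> R) :
  geo_decay z -> geo_decay (log_coef z).
Proof.
move=> [M [r [M0 r0 r1 cM]]].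
(* The index moves by one, which costs a division by the ratio; as r may be 0, the positive ratio (1
   + r) / 2 replaces it. *)
exists (M * (2 / (1 + r))), ((1 + r) / 2); split; [|lra|lra|].
  by rewrite mulr_ge0// divr_ge0//; lra.
have H (n : nat) : r ^+ n <= ((1 + r) / 2) ^+ n by rewrite lerXn2r ?nnegrE; lra.
case=> [|n] /=; first by rewrite normr0 expr0 mulr1 mulr_ge0// divr_ge0//; lra.
rewrite normrM normfV (ger0_norm (ler0n _ _)) ler_pdivrMr//.
rewrite [leRHS](_ : _ = M * (((1 + r) / 2) ^+ n * n.+1%:R)); last first.
  by rewrite exprS; field; lra.
rewrite (le_trans (cM n))// ler_wpM2l// (le_trans (H n))//.
by rewrite ler_peMr ?ler1n// exprn_ge0//; lra.
Qed.

Lemma pseries_diffs_log_coef {R : realType} (z : nat -> R) :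
  pseries_diffs (log_coef z) = z.
Proof.
by apply/funext => n; rewrite /pseries_diffs /= mulrC divfK ?pnatr_eq0.
Qed.

Lemma psum_log_coef0 {R : realType} (z : nat -> R) :
  geo_decay z -> psum (log_coef z) 0 = 0.
Proof. by move=> zg; rewrite psum0//; exact: geo_decay_log_coef. Qed.

Lemma is_derive_psum_log_coef {R : realType} (z : nat -> R) (x : R) :
  geo_decay z -> `|x| <= 1 ->
  is_derive x 1 (psum (log_coef z)) (psum z x).
Proof.
move=> zg x1; have := is_derive_psum _ _ (geo_decay_log_coef _ zg) x1.
by rewrite pseries_diffs_log_coef.
Qed.

Lemma is_derive_dilog {R : realType} (z : nat -> R) (x : R) :
  geo_decay z -> 0 < x <= 1 ->
  is_derive x 1 (dilog z) (psum (log_coef z) x / x).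
Proof.
move=> zg /andP[x0 x1].
have x1' : `|x| <= 1 by rewrite ger0_norm// ltW.
have lg := geo_decay_log_coef _ zg.
have := is_derive_psum_log_coef _ _ (geo_decay_shift _ lg) x1'.
by rewrite (psum_shift _ _ lg x1') add0r mulrC mulKf ?gt_eqF.
Qed.

Lemma dilog_ge0 {R : realType} (z : nat -> R) (x : R) :
  submultiplicative z -> 0 <= x <= 1 -> 0 <= dilog z x.
Proof.
move=> zs x01; have zg := geo_decay_submultiplicative _ zs; have [z0 _ _] := zs.
apply: psum_ge0 => //; last by do 2! [apply: log_coef_ge0 => // ?].
by apply/geo_decay_log_coef/geo_decay_shift/geo_decay_log_coef.
Qed.

Lemma psum_log_coef_ge0 {R : realType} (z : nat -> R) (x : R) :
  submultiplicative z -> 0 <= x <= 1 -> 0 <= psum (log_coef z) x.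
Proof.
move=> zs x01; have zg := geo_decay_submultiplicative _ zs; have [z0 _ _] := zs.
by apply: psum_ge0 => //; [exact: geo_decay_log_coef|exact: log_coef_ge0].
Qed.

Lemma psum_log_coef_le {R : realType} (z : nat -> R) (x y : R) :
  submultiplicative z -> 0 <= x -> x <= y -> y <= 1 ->
  psum (log_coef z) x <= psum (log_coef z) y.
Proof.
move=> zs x0 xy y1; have zg := geo_decay_submultiplicative _ zs.
have [z0 _ _] := zs.
apply: (ger0_is_derive_le _ (psum z)) => // t /andP[xt ty].
  by apply: is_derive_psum_log_coef => //; rewrite ger0_norm; lra.
by apply: psum_ge0 => //; lra.
Qed.

(** The left side collects f a * f b over the triangle a + b < n, which lies in the square a, b <
    n. *)
Lemma sum_cauchy_le {R : realDomainType} (f : nat -> R) (n : nat) :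
  (forall i, 0 <= f i) ->
  \sum_(0 <= i < n) \sum_(0 <= a < i.+1) f a * f (i - a)%N <=
  (\sum_(0 <= i < n) f i) ^+ 2.
Proof.
move=> f0.
have -> : \sum_(0 <= i < n) \sum_(0 <= a < i.+1) f a * f (i - a)%N =
    \sum_(0 <= a < n) f a * \sum_(0 <= b < n - a) f b.
  rewrite !big_mkord.
  under eq_bigr => i _ do
    rewrite big_mkord (big_ord_widen n (fun a => f a * f (i - a)%N))//.
  rewrite (exchange_big_dep xpredT)//=; apply: eq_bigr => a _.
  rewrite mulr_sumr.
  rewrite -(big_mkord (fun i => a < i.+1)%N (fun i => f a * f (i - a)%N)).
  rewrite (@big_cat_nat _ _ _ a)//=; last exact: ltnW.
  rewrite big_nat_cond big_pred0 ?Monoid.mul1m; last first.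
    by move=> i; rewrite /= ltnS; case: (ltnP i a) => //=; rewrite ?andbF.
  rewrite -{1}[nat_of_ord a]add0n big_addn.
  rewrite big_nat_cond [RHS]big_nat_cond; apply: eq_big => i.
    by rewrite ltnS leq_addl.
  by move=> _; rewrite addnK.
rewrite expr2 mulr_suml ler_sum// => a _; rewrite ler_wpM2l//.
by rewrite [leRHS](@big_cat_nat _ _ _ (n - a)) ?leq_subr//= lerDl sumr_ge0.
Qed.

(** The coefficient (i + 1) z_(i+1) of Z' is a sum of i + 1 copies of z_(i+1), one for each a <= i,
    and each is at most z_a z_(i-a); their sum is the coefficient of Z^2. *)
Lemma psum_diffs_le_sqr {R : realType} (z : nat -> R) (x : R) :
  submultiplicative z -> 0 <= x <= 1 ->
  psum (pseries_diffs z) x <= psum z x ^+ 2.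
Proof.
move=> zs /andP[x0 x1]; have zg := geo_decay_submultiplicative _ zs.
have [z0 _ zM] := zs.
have x1' : `|x| <= 1 by rewrite ger0_norm.
have f0 i : 0 <= z i * x ^+ i by rewrite mulr_ge0 ?exprn_ge0.
apply: limr_le.
  by apply: geo_decay_cvg1 => //; exact: geo_decay_diffs.
apply: nearW => n.
apply: (@le_trans _ _ ((\sum_(0 <= i < n) z i * x ^+ i) ^+ 2)).
  apply: le_trans (sum_cauchy_le _ n f0).
  apply: ler_sum => i _; rewrite /pseries_diffs.
  apply: (@le_trans _ _ (\sum_(0 <= a < i.+1) z i.+1 * x ^+ i)).
    by rewrite sumr_const_nat subn0 -mulr_natl mulrA.
  rewrite big_nat_cond [leRHS]big_nat_cond.
  apply: ler_sum => a /andP[/andP[_]]; rewrite ltnS => ai _.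
  rewrite mulrACA -exprD subnKC// ler_wpM2r ?exprn_ge0//.
  by have := zM a (i - a)%N; rewrite subnKC.
rewrite lerXn2r ?nnegrE//; [exact: sumr_ge0|by rewrite psum_ge0// x0|].
apply: (@nondecreasing_cvgn_le R (pseries z x)); last exact: geo_decay_cvg1.
by apply: nondecreasing_series => i _ _; exact: f0.
Qed.

(** * Monotonicity of X(x) + x for X = exp(-L) *)

Lemma is_derive_expRN {R : realType} (f : R -> R) (df x : R) :
  is_derive x 1 f df ->
  is_derive x 1 (fun t => expR (- f t)) (- df * expR (- f x)).
Proof.
move=> fdf; have := @is_derive1_comp R expR (fun t => - f t) x _ _
  (is_derive_expR _) (is_deriveN fdf).
by move=> H; apply: is_derive_eq; rewrite mulrC.
Qed.

(** The derivative of Z exp(-L) is (Z' - Z^2) exp(-L) <= 0, and the value at 0 is w_1 < 1. *)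
Lemma psum_expRN_le1 {R : realType} (z : nat -> R) (x : R) :
  submultiplicative z -> 0 <= x <= 1 ->
  psum z x * expR (- psum (log_coef z) x) <= 1.
Proof.
move=> zs /andP[x0 x1]; have zg := geo_decay_submultiplicative _ zs.
have [z0 z1 _] := zs.
apply: (@le_trans _ _ (psum z 0 * expR (- psum (log_coef z) 0))); last first.
  by rewrite psum_log_coef0// psum0// oppr0 expR0 mulr1 ltW.
pose df t := (psum (pseries_diffs z) t - psum z t ^+ 2) *
  expR (- psum (log_coef z) t).
apply: (ler0_is_derive_le
  (fun t => psum z t * expR (- psum (log_coef z) t)) df) => // t /andP[t0 tx].
  have t1 : `|t| <= 1 by rewrite ger0_norm; lra.
  have d1 := is_derive_psum _ _ zg t1.
  have d2 := is_derive_expRN _ _ _ (is_derive_psum_log_coef _ _ zg t1).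
  have := is_deriveM d1 d2; move=> H; apply: is_derive_eq.
  by rewrite /df /GRing.scale /=; ring.
rewrite pmulr_lle0 ?expR_gt0// subr_le0.
by apply: psum_diffs_le_sqr => //; lra.
Qed.

Lemma expRN_psumD_le {R : realType} (z : nat -> R) (x y : R) :
  submultiplicative z -> 0 <= x -> x <= y -> y <= 1 ->
  expR (- psum (log_coef z) x) + x <= expR (- psum (log_coef z) y) + y.
Proof.
move=> zs x0 xy y1; have zg := geo_decay_submultiplicative _ zs.
pose df t := 1 - psum z t * expR (- psum (log_coef z) t).
apply: (ger0_is_derive_le
  (fun t => expR (- psum (log_coef z) t) + t) df) => // t /andP[t0 tx].
  have t1 : `|t| <= 1 by rewrite ger0_norm; lra.
  have d2 := is_derive_expRN _ _ _ (is_derive_psum_log_coef _ _ zg t1).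
  have := is_deriveD d2 (is_derive_id t 1); move=> H; apply: is_derive_eq.
  by rewrite /df; ring.
by rewrite subr_ge0 psum_expRN_le1//; lra.
Qed.

(** * The minimum of ln x ln y + P(x) + P(y) *)

Lemma is_derive_dilogD {R : realType} (z : nat -> R) (b c x : R) :
  geo_decay z -> 0 < x <= 1 ->
  is_derive x 1 (fun t => ln t * b + dilog z t + c)
    ((b + psum (log_coef z) x) / x).
Proof.
move=> zg x01; have x0 : 0 < x by lra.
have d1 := is_derive1_ln x0; have d2 := is_derive_dilog _ _ zg x01.
have d3 := is_deriveM d1 (is_derive_cst b x 1).
have d4 := is_deriveD (is_deriveD d3 d2) (is_derive_cst c x 1).
apply: is_derive_eq.
by rewrite /GRing.scale /= mulr0 add0r addr0 mulrDl.
Qed.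

(** Here b stands for the logarithm of the fixed variable. The derivative (b + L(t)) / t passes from
    nonpositive to nonnegative at s because L is nondecreasing; in the second alternative it is
    nonpositive up to s = 1. *)
Lemma dilogD_min {R : realType} (z : nat -> R) (b c s x : R) :
  submultiplicative z -> 0 < s <= 1 -> 0 < x <= 1 ->
  b = - psum (log_coef z) s \/ s = 1 /\ b <= - psum (log_coef z) 1 ->
  ln s * b + dilog z s + c <= ln x * b + dilog z x + c.
Proof.
move=> zs /andP[s0 s1] /andP[x0 x1] bs.
have zg := geo_decay_submultiplicative _ zs.
have bs' : b <= - psum (log_coef z) s by case: bs => [->|[->]].
have [xs|sx] := leP x s.
  apply: (ler0_is_derive_le (fun t => ln t * b + dilog z t + c)
    (fun t => (b + psum (log_coef z) t) / t)) => // t /andP[xt ts].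
    by apply: is_derive_dilogD => //; lra.
  rewrite pmulr_lle0 ?invr_gt0; last lra.
  have := psum_log_coef_le z t s zs; lra.
have {bs} bs : b = - psum (log_coef z) s.
  by case: bs => // -[s1' _]; move: sx; rewrite s1' ltNge x1.
apply: (ger0_is_derive_le (fun t => ln t * b + dilog z t + c)
    (fun t => (b + psum (log_coef z) t) / t)) => //; first exact: ltW.
  by move=> t /andP[xt ts]; apply: is_derive_dilogD => //; lra.
move=> t /andP[st tx]; rewrite pmulr_lge0 ?invr_gt0; last lra.
have := psum_log_coef_le z s t zs; lra.
Qed.

Lemma expRN_psum_in01 {R : realType} (z : nat -> R) (x : R) :
  submultiplicative z -> 0 <= x <= 1 -> 0 < expR (- psum (log_coef z) x) <= 1.
Proof.
move=> zs x01.
by rewrite expR_gt0 expR_le1 oppr_le0 psum_log_coef_ge0.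
Qed.

(* The part X(x) <= x of the curve y = X(x). *)
Lemma dilog_curve_ge {R : realType} (z : nat -> R) (x : R) :
  submultiplicative z -> 0 < x <= 1 -> expR (- psum (log_coef z) x) <= x ->
  dilog z 1 <= ln x * - psum (log_coef z) x + dilog z x
               + dilog z (expR (- psum (log_coef z) x)).
Proof.
move=> zs /andP[x0 x1]; set L := psum (log_coef z) => Xx.
have zg := geo_decay_submultiplicative _ zs.
pose M t := ln t * - L t + dilog z t + dilog z (expR (- L t)).
apply: (@le_trans _ _ (M 1)).
  rewrite /M ln1 mul0r add0r lerDl dilog_ge0//.
  have := @expRN_psum_in01 R z 1 zs; rewrite -/L; lra.
(* The terms L(t) / t cancel, and P(X(t)) contributes (L(X) / X) (- Z X) = - Z L(X). *)
apply: (ler0_is_derive_le M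
  (fun t => - (psum z t * (ln t + L (expR (- L t)))))) => //.
  move=> t /andP[xt t1]; have t0 : 0 < t by lra.
  have t1' : `|t| <= 1 by rewrite ger0_norm; lra.
  have t01 : 0 < t <= 1 by rewrite t0.
  have X01 : 0 < expR (- L t) <= 1 by apply: expRN_psum_in01 => //; lra.
  have dL := is_derive_psum_log_coef _ _ zg t1'.
  have d1 := is_deriveM (is_derive1_ln t0) (is_deriveN dL).
  have d2 := is_deriveD d1 (is_derive_dilog _ _ zg t01).
  have d3 := @is_derive1_comp R (dilog z) (fun t => expR (- L t)) t _ _
    (is_derive_dilog _ _ zg X01) (is_derive_expRN _ _ _ dL).
  have d4 := is_deriveD d2 d3; apply: is_derive_eq.
  rewrite /GRing.scale /= -/L (_ : (- L) t = - L t)//.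
  by field; rewrite !gt_eqF//; case/andP: X01.
move=> t /andP[xt t1]; rewrite oppr_le0 mulr_ge0//.
  have [z0 _ _] := zs; apply: psum_ge0 => //; lra.
have t0 : 0 < t by lra.
have X01 : 0 < expR (- L t) <= 1 by apply: expRN_psum_in01 => //; lra.
(* The hypothesis at x persists on [x, 1]: X(t) <= X(x) <= x <= t. *)
have Xt : expR (- L t) <= t.
  rewrite (le_trans _ xt)// (le_trans _ Xx)// ler_expR lerN2.
  by apply: psum_log_coef_le => //; lra.
(* Comparing X(u) + u at u = X(t) and u = t gives X(X(t)) <= t; its logarithm is the required
   sign. *)
have := @expRN_psumD_le R z (expR (- L t)) t zs; rewrite -/L.
have -> : 0 <= expR (- L t) by lra.
move=> /(_ isT Xt t1) H.
have {}H : expR (- L (expR (- L t))) <= expR (ln t) by rewrite lnK ?posrE//; lra.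
by rewrite ler_expR in H; lra.
Qed.

(* The second alternative covers y < X(1), where the minimum is at s = 1. *)
Lemma dilog_exists_curve {R : realType} (z : nat -> R) (y : R) :
  submultiplicative z -> 0 < y < 1 ->
  exists2 s, 0 < s <= 1 &
    ln y = - psum (log_coef z) s \/ s = 1 /\ ln y <= - psum (log_coef z) 1.
Proof.
move=> zs /andP[y0 y1]; have zg := geo_decay_submultiplicative _ zs.
have [yL|yL] := leP (ln y) (- psum (log_coef z) 1).
  by exists 1; [rewrite ltr01 lexx|right].
have L0 := psum_log_coef0 z zg.
have lny : ln y < 0 by rewrite ln_lt0// y0.
have cf : {within `[0, 1], continuous (psum (log_coef z))}.
  apply: derivable_within_continuous => x; rewrite in_itv/= => /andP[x0 x1].
  by have [] := is_derive_psum_log_coef _ x zg; rewrite ?ger0_norm.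
have [|s] := @IVT R _ 0 1 (- ln y) ler01 cf.
  by rewrite L0 ge_min le_max; lra.
rewrite in_itv/= => /andP[s0 s1] sE; exists s; last by left; lra.
rewrite s1 andbT lt_neqAle s0 andbT eq_sym; apply/eqP => s0'.
by move: sE; rewrite s0' L0; lra.
Qed.

(** Minimising over x leads to a point (s, y). If y <= s the curve estimate applies; otherwise
    minimising over y with s fixed leads to (s', s) with s <= s', where it applies after exchanging
    the variables. *)
Lemma dilog_ineq {R : realType} (z : nat -> R) (x y : R) :
  submultiplicative z -> 0 < x <= 1 -> 0 < y <= 1 ->
  dilog z 1 <= ln x * ln y + dilog z x + dilog z y.
Proof.
move=> zs.
have base (u : R) : 0 < u <= 1 ->
    dilog z 1 <= ln 1 * ln u + dilog z 1 + dilog z u.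
  by move=> u01; rewrite ln1 mul0r add0r lerDl dilog_ge0//; lra.
have curve (s u : R) : 0 < s <= 1 -> 0 < u <= 1 -> u <= s ->
    ln u = - psum (log_coef z) s \/ s = 1 /\ ln u <= - psum (log_coef z) 1 ->
    dilog z 1 <= ln s * ln u + dilog z s + dilog z u.
  move=> s01 u01 us [uE|[-> _]]; last exact: base.
  have uE' : u = expR (- psum (log_coef z) s) by rewrite -uE lnK// posrE; lra.
  rewrite uE uE'; apply: dilog_curve_ge => //; lra.
move=> x01 y01; have [y1|] := eqVneq y 1.
  by have := base x x01; rewrite y1 mulrC addrAC.
move=> yN1; have {}y1 : 0 < y < 1 by rewrite [y < 1]lt_neqAle yN1; lra.
have [s s01 sy] := dilog_exists_curve z y zs y1.
apply: le_trans (dilogD_min z _ _ _ _ zs s01 x01 sy).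
have [ys|sy'] := leP y s; first exact: curve.
have s1 : 0 < s < 1 by lra.
have [s' s01' sy''] := dilog_exists_curve z s zs s1.
have ss : s <= s'.
  case: sy'' => [sE|[-> _]]; last lra.
  case: sy => [yE|[]]; last lra.
  (* Since X is nonincreasing, s' < s would give y = X(s) <= X(s') = s, against s < y. *)
  rewrite leNgt; apply/negP => s's.
  have e1 : expR (- psum (log_coef z) s) = y by rewrite -yE lnK// posrE; lra.
  have e2 : expR (- psum (log_coef z) s') = s by rewrite -sE lnK// posrE; lra.
  have : expR (- psum (log_coef z) s) <= expR (- psum (log_coef z) s').
    by rewrite ler_expR lerN2 psum_log_coef_le//; lra.
  lra.
have := dilogD_min z (ln s) (dilog z s) s' y zs s01' y01 sy''.
rewrite mulrC => H; have := curve s' s s01' _ ss sy''.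
lra.
Qed.

(** * The weights *)

(* coth t >= 1 / t, with a = exp(-2 t). *)
Lemma ln_pade_le {R : realType} (a : R) :
  0 < a <= 1 -> 2 * (1 - a) <= (1 + a) * - ln a.
Proof.
move=> /andP[a0 a1].
suff : (1 + a) * ln a - 2 * a <= (1 + 1) * ln 1 - 2 * 1 by rewrite ln1; lra.
apply: (ger0_is_derive_le (fun t => (1 + t) * ln t - 2 * t)
  (fun t => ln t + t^-1 - 1)) => [//|t|t] /andP[at_ t1];
  have t0 : 0 < t by lra.
  have d1 := is_deriveD (is_derive_cst (1 : R) t 1) (is_derive_id t 1).
  have d2 := is_deriveM d1 (is_derive1_ln t0).
  have d3 := is_deriveM (is_derive_cst (2 : R) t 1) (is_derive_id t 1).
  have d4 := is_deriveB d2 d3; apply: is_derive_eq.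
  rewrite /GRing.scale /= (_ : (cst 1 + id) t = 1 + t)//.
  by field; rewrite gt_eqF.
have := @le_ln1Dx R (t^-1 - 1); rewrite [1 + _]addrC subrK lnV ?posrE// => H.
have : -1 < t^-1 - 1 by have : 0 < t^-1 by [rewrite invr_gt0]; lra.
by move=> /H; lra.
Qed.

(* t <= sinh t, with s = exp(-t). *)
Lemma ln_sinh_le {R : realType} (s : R) :
  0 < s <= 1 -> 2 * s * - ln s <= 1 - s ^+ 2.
Proof.
move=> /andP[s0 s1].
suff : 1 - 1 ^+ 2 + 2 * 1 * ln 1 <= 1 - s ^+ 2 + 2 * s * ln s by rewrite ln1; lra.
apply: (ler0_is_derive_le (fun t => 1 - t ^+ 2 + 2 * t * ln t)
  (fun t => 2 * (ln t - t + 1))) => [//|t|t] /andP[st t1];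
  have t0 : 0 < t by lra.
  have d1 := is_deriveB (is_derive_cst (1 : R) t 1)
    (is_deriveX 2 (is_derive_id t 1)).
  have d2 := is_deriveM
    (is_deriveM (is_derive_cst (2 : R) t 1) (is_derive_id t 1)) (is_derive1_ln t0).
  have d4 := is_deriveD d1 d2; apply: is_derive_eq.
  rewrite /GRing.scale /= (_ : (cst 2 * id) t = 2 * t)// .
  by field; rewrite gt_eqF.
by have := @le_ln1Dx R (t - 1); rewrite [1 + _]addrC subrK; lra.
Qed.

(* sinh((n + 1) t) / (n + 1) < sinh((n + 2) t) / (n + 2), with s = exp(-t). *)
Lemma sinh_ratio_lt {R : realDomainType} (s : R) (n : nat) :
  0 < s < 1 ->
  n.+2%:R * s * (1 - s ^+ (2 * n.+1)) < n.+1%:R * (1 - s ^+ (2 * n.+2)).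
Proof.
move=> /andP[s0 s1].
elim: n => [|n IH].
  rewrite (_ : 2 * 1 = 2)%N// (_ : 2 * 2 = 4)%N// -subr_gt0.
  have -> : 1 * (1 - s ^+ 4) - 2 * s * (1 - s ^+ 2) =
      (1 - s) ^+ 2 * ((1 - s) * (1 + s)).
    by ring.
  by rewrite mulr_gt0 ?exprn_gt0 ?mulr_gt0//; lra.
have p : 0 < 1 - s ^+ (2 * n.+2) by rewrite subr_gt0 exprn_ilt1 ?ltW.
(* The sequence 1 - s^(2 n) satisfies the linear recurrence with characteristic roots 1 and s^2. *)
have -> : 1 - s ^+ (2 * n.+3) =
    (1 + s ^+ 2) * (1 - s ^+ (2 * n.+2)) - s ^+ 2 * (1 - s ^+ (2 * n.+1)).
  by rewrite !mulnS !exprD; ring.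
rewrite -[n.+3%:R]natr1 -[n.+2%:R]natr1 in IH *.
move: p IH; move: (1 - s ^+ (2 * n.+2)) (1 - s ^+ (2 * n.+1)) => u v.
have : 0 < n.+1%:R :> R by rewrite ltr0n.
move: (n.+1%:R) => N N0 u0 IH.
rewrite -subr_gt0.
have -> : (N + 1) * ((1 + s ^+ 2) * u - s ^+ 2 * v) - (N + 1 + 1) * s * u =
   s * (N * u - (N + 1) * s * v) + (N + 1) * (u * (1 - s) ^+ 2) by ring.
rewrite addr_gt0 ?mulr_gt0 ?exprn_gt0//; lra.
Qed.

(* n coth(n t) <= (n + 1) coth((n + 1) t), with a = exp(-2 t). *)
Lemma coth_ratio_le {R : realDomainType} (a : R) (n : nat) :
  0 <= a <= 1 ->
  n%:R * ((1 + a ^+ n) * (1 - a ^+ n.+1)) <=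
  n.+1%:R * ((1 + a ^+ n.+1) * (1 - a ^+ n)).
Proof.
move=> /andP[a0 a1].
(* This is the difference of the two sides. For a < 1, division by 1 - a shows it as the AM-GM
   inequality for 1, a, ..., a^(2 n), whose geometric mean is a^n. *)
suff H : 0 <= 1 - a ^+ (2 * n).+1 - (2 * n).+1%:R * a ^+ n * (1 - a).
  rewrite -subr_ge0 (le_trans H)// le_eqVlt; apply/orP; left; apply/eqP.
  by rewrite -!natr1 natrM mul2n -addnn !exprS exprD; ring.
elim: n => [|n IH]; first by rewrite muln0 expr1 expr0; lra.
have -> : 1 - a ^+ (2 * n.+1).+1 - (2 * n.+1).+1%:R * a ^+ n.+1 * (1 - a) =
   a * (1 - a ^+ (2 * n).+1 - (2 * n).+1%:R * a ^+ n * (1 - a)) +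
   (1 - a) * (1 - a ^+ n.+1) ^+ 2.
  have N1 : (2 * n.+1).+1%:R = 2 * n%:R + 3 :> R.
    by rewrite -natr1 mulnS natrD natrM; ring.
  have N2 : (2 * n).+1%:R = 2 * n%:R + 1 :> R by rewrite -natr1 natrM.
  by rewrite N1 N2 !mul2n doubleS -addnn !exprS exprD; ring.
by apply: addr_ge0; [exact: mulr_ge0|rewrite mulr_ge0 ?sqr_ge0 ?subr_ge0].
Qed.

(* c(a) of the header: the exponents not divisible by m, in blocks of length m. *)
Definition nonmultiple_coef {R : realType} (m : nat) (a : R) : R :=
  (\sum_(1 <= r < m) a ^+ r) / (1 - a ^+ m).

Lemma nonmultiple_coefE {R : realType} (n : nat) (a : R) :
  0 <= a < 1 -> nonmultiple_coef n.+1 a =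
  a * (1 - a ^+ n) / ((1 - a) * (1 - a ^+ n.+1)).
Proof.
move=> /andP[a0 a1]; rewrite /nonmultiple_coef big_add1 /=.
have -> : \sum_(0 <= i < n) a ^+ i.+1 = a * (1 - a ^+ n) / (1 - a).
  under eq_bigr do rewrite exprS.
  by rewrite -mulr_sumr big_mkord -opprB subrX1 -mulNr opprB; field; lra.
by rewrite invfM mulrA.
Qed.

(* [weight m (q ^+ i)] is w_i. *)
Definition weight {R : realType} (m : nat) (a : R) : R :=
  m%:R / m.-1%:R * - ln a * nonmultiple_coef m a.

Lemma nonmultiple_coef_ge0 {R : realType} (m : nat) (a : R) :
  0 <= a <= 1 -> 0 <= nonmultiple_coef m a.
Proof.
move=> /andP[a0 a1]; rewrite divr_ge0 ?subr_ge0 ?exprn_ile1//.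
by apply: sumr_ge0 => i _; rewrite exprn_ge0.
Qed.

Lemma weight_ge0 {R : realType} (m : nat) (a : R) : 0 < a <= 1 -> 0 <= weight m a.
Proof.
move=> /andP[a0 a1]; apply: mulr_ge0.
  by rewrite mulr_ge0 ?divr_ge0// oppr_ge0 ln_le0.
by apply: nonmultiple_coef_ge0; rewrite a1 ltW.
Qed.

(** With a = exp(-2 t) the weight is t / sinh t times m sinh((m - 1) t) / ((m - 1) sinh(m t)); the
    first factor is at most 1, the second less than 1. The square root s of a is exp(-t). *)
Lemma weight_lt1 {R : realType} (n : nat) (a : R) :
  0 < a < 1 -> weight n.+2 a < 1.
Proof.
move=> /andP[a0 a1]; rewrite /weight nonmultiple_coefE ?a1 ?ltW//=.
pose s := Num.sqrt a.
have s0 : 0 < s by rewrite sqrtr_gt0.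
have s1 : s < 1 by rewrite -sqrtr1 ltr_sqrt.
have as2 : a = s ^+ 2 by rewrite sqr_sqrtr// ltW.
rewrite as2 lnXn// -[ln s *+ 2]mulr_natl -!exprM.
have P k : 0 < 1 - s ^+ (2 * k.+1) by rewrite subr_gt0 exprn_ilt1 ?ltW.
have := P 0%N; rewrite muln1 => P0.
have s01 : 0 < s <= 1 by lra.
have s01' : 0 < s < 1 by lra.
have := ln_sinh_le _ s01; have := sinh_ratio_lt _ n s01'.
have := P n.+1; have := P n.
have : 0 < n.+1%:R :> R by rewrite ltr0n.
have : 0 < n.+2%:R :> R by rewrite ltr0n.
move: (n.+1%:R) (n.+2%:R) (s ^+ (2 * n.+1)) (s ^+ (2 * n.+2)).
move=> N N' u u' N'0 N0 u1 u'1 h1 h2.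
rewrite (_ : _ * _ = (2 * s * - ln s * (N' * s * (1 - u))) /
   (N * ((1 - s ^+ 2) * (1 - u')))); last by field; rewrite !gt_eqF.
rewrite ltr_pdivrMr ?mulr_gt0// mul1r [ltRHS]mulrCA.
rewrite (le_lt_trans (ler_wpM2r _ h2)) ?ltr_pM2l//.
by rewrite !mulr_ge0// ltW.
Qed.

Lemma weightM_le {R : realType} (n : nat) (a b : R) :
  0 < a < 1 -> 0 < b < 1 ->
  weight n.+2 (a * b) <= weight n.+2 a * weight n.+2 b.
Proof.
move=> /andP[a0 a1] /andP[b0 b1].
have ab1 : a * b < 1 by rewrite mulr_ilt1 ?ltW.
have ab0 : 0 < a * b by rewrite mulr_gt0.
rewrite /weight !nonmultiple_coefE ?(ltW a0) ?(ltW b0) ?(ltW ab0) ?a1 ?b1 ?ab1//=.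
rewrite lnM ?posrE// !exprMn.
have a01 : 0 < a <= 1 by lra.
have b01 : 0 < b <= 1 by lra.
have a01' : 0 <= a <= 1 by lra.
have b01' : 0 <= b <= 1 by lra.
have la := ln_pade_le _ a01; have lb := ln_pade_le _ b01.
have ca := coth_ratio_le _ n.+1 a01'; have cb := coth_ratio_le _ n.+1 b01'.
have Pa k : 0 < a ^+ k.+1 < 1 by rewrite exprn_gt0// exprn_ilt1 ?ltW.
have Pb k : 0 < b ^+ k.+1 < 1 by rewrite exprn_gt0// exprn_ilt1 ?ltW.
have {Pa} := (Pa n, Pa n.+1); have {Pb} := (Pb n, Pb n.+1).
have : 0 < n.+1%:R :> R by rewrite ltr0n.
(* From here on N = m - 1, A = a^N, A' = a^(N+1), B and B' are the same powers of b, and x = - ln a,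
   y = - ln b; the claim becomes one about free variables. *)
move: ca cb; rewrite -[n.+2%:R]natr1; move: (n.+1%:R) => N.
move: (a ^+ n.+1) (a ^+ n.+2) (b ^+ n.+1) (b ^+ n.+2) => A A' B B' ca cb N0.
move=> [/andP[B0 B1] /andP[B'0 B'1]] [/andP[A0 A1] /andP[A'0 A'1]].
have l1 : 0 <= - ln a by rewrite oppr_ge0 ln_le0// ltW.
have l2 : 0 <= - ln b by rewrite oppr_ge0 ln_le0// ltW.
move: la lb l1 l2; rewrite opprD; move: (- ln a) (- ln b) => x y la lb x0 y0.
have AB1 : A * B < 1 by rewrite mulr_ilt1 ?ltW.
have AB1' : A' * B' < 1 by rewrite mulr_ilt1 ?ltW.
(* The factor (1 - a b) / ((1 - a) (1 - b)) of both steps is half the sum of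
   (1 + a) / (1 - a) and (1 + b) / (1 - b). *)
have step1 : (x + y) * ((1 - a) * (1 - b)) <= x * y * (1 - a * b).
  have h1 : 0 <= y * (1 - b) * ((1 + a) * x - 2 * (1 - a)).
    by rewrite !mulr_ge0// ?subr_ge0// ltW.
  have h2 : 0 <= x * (1 - a) * ((1 + b) * y - 2 * (1 - b)).
    by rewrite !mulr_ge0// ?subr_ge0// ltW.
  lra.
have step2 : N * ((1 - A') * (1 - B') * (1 - A * B)) <=
    (N + 1) * ((1 - A) * (1 - B) * (1 - A' * B')).
  have h1 : 0 <= (1 - B) * (1 - B') *
      ((N + 1) * ((1 + A') * (1 - A)) - N * ((1 + A) * (1 - A'))).
    by rewrite !mulr_ge0// ?subr_ge0// ltW.
  have h2 : 0 <= (1 - A) * (1 - A') *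
      ((N + 1) * ((1 + B') * (1 - B)) - N * ((1 + B) * (1 - B'))).
    by rewrite !mulr_ge0// ?subr_ge0// ltW.
  lra.
move: (a1) (b1) (A1) (B1) (A'1) (B'1) (ab1) (AB1) (AB1').
rewrite -![_ < 1]subr_gt0 => a1' b1' A1' B1' A'1' B'1' ab1' AB1'' A'B'1.
have D1 : 0 < (1 - a) * (1 - b) * (1 - a * b) by rewrite !mulr_gt0.
have D2 : 0 < N * ((1 - A') * (1 - B') * (1 - A' * B')) by rewrite !mulr_gt0.
(* Over the common denominator, the numerator is a positive factor times the product of the larger
   sides of [step1] and [step2] minus that of the smaller sides. *)
rewrite -subr_ge0 (_ : _ - _ = (N + 1) / N * (a * b) *
   (x * y * (1 - a * b) * ((N + 1) * ((1 - A) * (1 - B) * (1 - A' * B')))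
   - (x + y) * ((1 - a) * (1 - b)) * (N * ((1 - A') * (1 - B') * (1 - A * B)))) /
   ((1 - a) * (1 - b) * (1 - a * b) * (N * ((1 - A') * (1 - B') * (1 - A' * B')))));
  last by clear -a1' b1' A'1' B'1' ab1' A'B'1 N0; field; rewrite !gt_eqF.
apply: divr_ge0; last exact: ltW (mulr_gt0 D1 D2).
apply: mulr_ge0; first by rewrite mulr_ge0 ?divr_ge0 ?addr_ge0// ltW.
rewrite subr_ge0; apply: ler_pM => //.
  by rewrite mulr_ge0 ?addr_ge0// ltW// mulr_gt0.
by rewrite ltW// !mulr_gt0.
Qed.

Lemma weight_submultiplicative {R : realType} (m : nat) (q : R) :
  0 < q < 1 -> (2 <= m)%N ->
  submultiplicative (fun n => weight m (q ^+ n.+1)).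
Proof.
case: m => [|[|m]]// /andP[q0 q1] _.
have P k : 0 < q ^+ k.+1 < 1 by rewrite exprn_gt0// exprn_ilt1 ?ltW.
split => [n||i j].
- by apply: weight_ge0; have /andP[-> /ltW] := P n.
- exact: weight_lt1.
- by rewrite -addSn -addnS exprD weightM_le.
Qed.

(** * The infinite products *)

Lemma psum_geometric {R : realType} (t x : R) :
  `|t * x| < 1 -> psum (fun n => t ^+ n.+1) x = t / (1 - t * x).
Proof.
move=> tx1; apply: cvg_lim => //.
rewrite (_ : pseries _ x = series (geometric t (t * x))).
  exact: cvg_geometric_series.
apply/funext => n; rewrite /pseries /series /=.
by apply: eq_bigr => i _; rewrite exprS exprMn mulrA.
Qed.

Lemma geo_decay_geometric {R : realType} (t : R) :
  0 <= t < 1 -> geo_decay (fun n => t ^+ n.+1).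
Proof.
move=> /andP[t0 t1]; exists t, t; split=> // n.
by rewrite ger0_norm ?exprn_ge0// exprS.
Qed.

(** Both sides vanish at x = 0 and have the derivative t / (1 - t x). *)
Lemma psum_log {R : realType} (t x : R) :
  0 <= t < 1 -> 0 <= x <= 1 ->
  psum (log_coef (fun n => t ^+ n.+1)) x = - ln (1 - t * x).
Proof.
move=> /andP[t0 t1] /andP[x0 x1].
have tg : geo_decay (fun n => t ^+ n.+1) by apply: geo_decay_geometric; rewrite t0.
pose h u := psum (log_coef (fun n => t ^+ n.+1)) u + ln (1 - t * u).
have dh u : 0 <= u <= x -> is_derive u 1 h 0.
  move=> /andP[u0 ux].
  have u1 : `|u| <= 1 by rewrite ger0_norm//; lra.
  have tu : t * u < 1 by rewrite (le_lt_trans _ t1)// ler_piMr//; lra.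
  have d1 := is_derive_psum_log_coef _ _ tg u1.
  have d2 := is_deriveM (is_derive_cst (t : R) u 1) (is_derive_id u 1).
  have d3 := is_deriveB (is_derive_cst (1 : R) u 1) d2.
  have tu0 : 0 < 1 - t * u by rewrite subr_gt0.
  have d4 := @is_derive1_comp R (@ln R) (fun u => 1 - t * u) u _ _
    (is_derive1_ln tu0) d3.
  have d5 := is_deriveD d1 d4; apply: is_derive_eq.
  rewrite psum_geometric; last by rewrite ger0_norm ?mulr_ge0.
  by rewrite /GRing.scale /=; field; rewrite gt_eqF.
have h0 : h 0 = 0 by rewrite /h psum_log_coef0// mulr0 subr0 ln1 addr0.
have h1 := ger0_is_derive_le h (fun=> 0) _ _ x0 dh (fun _ _ => lexx 0).
have h2 := ler0_is_derive_le h (fun=> 0) _ _ x0 dh (fun _ _ => lexx 0).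
by apply/eqP; rewrite -subr_eq0 opprK -/(h x) -h0 eq_le h2.
Qed.

(** The constant kappa. *)
Definition weight_scale {R : realType} (m : nat) (q : R) : R :=
  m%:R / m.-1%:R * - ln q.

Local Notation qdilog m q := (dilog (fun n => weight m (q ^+ n.+1))).

(** Passing from x to x Q multiplies the i-th term by Q^i, and 1 - Q^i cancels the denominator of
    c(q^i). What remains is kappa times the sum of q^(r i) x^i / i over 0 < r < m, a sum of
    logarithmic series. *)
Lemma qdilog_step {R : realType} (m : nat) (q x : R) :
  0 < q < 1 -> (2 <= m)%N -> 0 <= x <= 1 ->
  qdilog m q x - qdilog m q (x * q ^+ m) =
  weight_scale m q * \sum_(1 <= r < m) - ln (1 - q ^+ r * x).
Proof.
move=> q01 m2 /andP[x0 x1]; have /andP[q0 q1] := q01.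
have Q01 : 0 < q ^+ m < 1.
  by rewrite exprn_gt0// exprn_ilt1 ?ltW// -lt0n ltnW.
have ws := weight_submultiplicative m q q01 m2.
have wg := geo_decay_submultiplicative _ ws.
set p := log_coef (fun n => log_coef (fun n => weight m (q ^+ n.+1)) n.+1).
have pg : geo_decay p by apply/geo_decay_log_coef/geo_decay_shift/geo_decay_log_coef.
have sx1 : `|x * q ^+ m| <= 1.
  by case/andP: Q01 => /ltW Q0 /ltW Q1; rewrite ger0_norm ?mulr_ge0 ?mulr_ile1.
have x1' : `|x| <= 1 by rewrite ger0_norm.
have c1 := geo_decay_cvg1 _ _ pg x1'; have c2 := geo_decay_cvg1 _ _ pg sx1.
have cL : (pseries p x - pseries p (x * q ^+ m)) @ \oo -->
    psum p x - psum p (x * q ^+ m) by exact: cvgB.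
pose lg r := log_coef (fun n => (q ^+ r) ^+ n.+1).
have qr r : (1 <= r)%N -> 0 <= q ^+ r < 1.
  by move=> r1; rewrite exprn_ge0 ?ltW//= exprn_ilt1 ?ltW// -lt0n.
have cr : weight_scale m q * \sum_(1 <= r < m) pseries (lg r) x n @[n --> \oo] -->
    weight_scale m q * \sum_(1 <= r < m) - ln (1 - q ^+ r * x).
  apply: cvgM; first exact: cvg_cst.
  elim: (m) => [|[|k] IH];
    [by under eq_fun do rewrite big_geq//; rewrite big_geq//; exact: cvg_cst..|].
  rewrite big_nat_recr//=; under eq_fun do rewrite big_nat_recr//=.
  apply: cvgD => //; rewrite -psum_log ?x0 ?qr//.
  by apply: geo_decay_cvg1 => //; apply/geo_decay_log_coef/geo_decay_geometric/qr.
(* Both sides are limits of partial sums, which agree for every n. *)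
suff E : pseries p x - pseries p (x * q ^+ m) =
    (fun n => weight_scale m q * \sum_(1 <= r < m) pseries (lg r) x n).
  by rewrite E in cL; rewrite -(cvg_lim _ cr)// (cvg_lim _ cL).
apply/funext => n.
rewrite [LHS](_ : _ = pseries p x n - pseries p (x * q ^+ m) n)//.
rewrite /pseries /series /= exchange_big /= mulr_sumr -sumrB.
apply: eq_bigr => -[|i] _ /=.
  by rewrite big1 ?mulr0 ?mul0r ?subrr// => r _; rewrite mul0r.
rewrite /weight /nonmultiple_coef /weight_scale -mulr_suml exprMn -exprM lnXn//.
have -> : \sum_(1 <= r < m) (q ^+ i.+1) ^+ r = \sum_(1 <= r < m) (q ^+ r) ^+ i.+1.
  by apply: eq_bigr => r _; rewrite -!exprM mulnC.
rewrite -mulr_suml -[ln q *+ _]mulr_natl -[(q ^+ m) ^+ _]exprM mulnC.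
have : 1 - q ^+ (m * i.+1) != 0.
  by rewrite subr_eq0 eq_sym lt_eqF// exprn_ilt1 ?(ltW q0)// -lt0n muln_gt0 ltnW.
have : m.-1%:R != 0 :> R by rewrite pnatr_eq0; case: (m) m2 => // -[].
have : i.+1%:R != 0 :> R by rewrite pnatr_eq0.
move: (\sum_(_ <= _ < _) _) (q ^+ (m * _)) (m%:R) (m.-1%:R) (i.+1%:R).
by move=> S Q a b c c0 b0 Q1; field; rewrite c0 b0 Q1.
Qed.

(** The one-step identity telescopes along x, x Q, x Q^2, and so on. Positivity is carried through
    the same induction because the logarithm of the product is split at each step. *)
Lemma qdilog_prod {R : realType} (m : nat) (q x : R) (N : nat) :
  0 < q < 1 -> (2 <= m)%N -> 0 <= x <= 1 ->
  qdilog m q (x * q ^+ (m * N)) - qdilog m q x =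
  weight_scale m q *
  ln (\prod_(0 <= i < N) \prod_(1 <= r < m) (1 - x * q ^+ (m * i + r))) /\
  0 < \prod_(0 <= i < N) \prod_(1 <= r < m) (1 - x * q ^+ (m * i + r)).
Proof.
move=> q01 m2 /andP[x0 x1]; have /andP[q0 q1] := q01.
have F0 i r : (0 < r)%N -> 0 < 1 - x * q ^+ (m * i + r).
  move=> r0; rewrite subr_gt0 (le_lt_trans (ler_piMl _ x1))//.
    by rewrite exprn_ge0 ?ltW.
  by rewrite exprn_ilt1 ?(ltW q0)// addn_eq0 negb_and -!lt0n r0 orbT.
have P0 i k : 0 < \prod_(1 <= r < k) (1 - x * q ^+ (m * i + r)).
  rewrite big_nat_cond; apply: prodr_gt0 => r /andP[/andP[r0 _] _]; exact: F0.
elim: N => [|N [IH W0]].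
  by rewrite muln0 expr0 mulr1 subrr !big_geq// ln1 mulr0.
rewrite big_nat_recr//=; split; last by rewrite mulr_gt0.
rewrite lnM ?posrE// mulrDr -IH mulnS addnC exprD mulrA.
have xN : 0 <= x * q ^+ (m * N) <= 1.
  by rewrite mulr_ge0 ?mulr_ile1 ?exprn_ge0 ?exprn_ile1 ?(ltW q0) ?(ltW q1).
have := qdilog_step _ _ _ q01 m2 xN.
have -> k : \sum_(1 <= r < k) - ln (1 - q ^+ r * (x * q ^+ (m * N))) =
    - ln (\prod_(1 <= r < k) (1 - x * q ^+ (m * N + r))).
  elim: k => [|[|k] IHk]; [by rewrite !big_geq// ln1 oppr0..|].
  rewrite big_nat_recr//= IHk [in RHS]big_nat_recr//= lnM ?posrE//; last exact: F0.
  by rewrite opprD exprD mulrCA [q ^+ k.+1 * _]mulrC.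
by rewrite mulrN; lra.
Qed.

(** * Splitting q-Pochhammer symbols by residues modulo m *)

Lemma qpoch_split {R : realType} (m N : nat) (q x : R) : (0 < m)%N ->
  qpoch x q (m * N) = qpoch x (q ^+ m) N *
    \prod_(0 <= i < N) \prod_(1 <= r < m) (1 - x * q ^+ (m * i + r)).
Proof.
move=> m0; elim: N => [|N IH]; first by rewrite muln0 /qpoch !big_geq// mulr1.
rewrite {1}/qpoch mulnS addnC (@big_cat_nat _ _ _ (m * N)) ?leq_addr//=.
rewrite -/(qpoch x q (m * N)) IH.
rewrite -{1}[(m * N)%N]add0n big_addn addKn.
rewrite [\prod_(0 <= i < m) _]big_ltn// add0n [in RHS]big_nat_recr//=.
rewrite /qpoch big_nat_recr//= -/(qpoch _ _ N).
rewrite exprM mulrACA; congr (_ * (_ * _)).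
by apply: eq_bigr => r _; rewrite addnC.
Qed.

(** The exponents now run from 1 to m N, so the multiple of m ends each block instead of starting
    it. The factor 1 gives the remaining product the shape of the general one at x = 1. *)
Lemma qpoch_self_split {R : realType} (m N : nat) (q : R) : (0 < m)%N ->
  qpoch q q (m * N) = qpoch (q ^+ m) (q ^+ m) N *
    \prod_(0 <= i < N) \prod_(1 <= r < m) (1 - 1 * q ^+ (m * i + r)).
Proof.
move=> m0; elim: N => [|N IH]; first by rewrite muln0 /qpoch !big_geq// mulr1.
rewrite {1}/qpoch mulnS addnC (@big_cat_nat _ _ _ (m * N)) ?leq_addr//=.
rewrite -/(qpoch q q (m * N)) IH.
rewrite -{1}[(m * N)%N]add0n big_addn addKn.
rewrite [in RHS]big_nat_recr//= /qpoch big_nat_recr//= -/(qpoch _ _ N) [RHS]mulrACA.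
congr (_ * _); rewrite mulrC -exprS.
case: m m0 {IH} => // m _; rewrite big_nat_recr//= big_add1/=; congr (_ * _).
  by apply: eq_bigr => r _; rewrite mul1r -exprS addnS addnC.
by rewrite -exprM -exprS -addSn mulnS.
Qed.

Lemma qpoch_ge0 {R : realType} (q x : R) (n : nat) :
  0 < q < 1 -> 0 <= x <= 1 -> 0 <= qpoch x q n.
Proof.
move=> /andP[q0 q1] /andP[x0 x1]; apply: prodr_ge0 => i _.
by rewrite subr_ge0 mulr_ile1 ?exprn_ge0 ?exprn_ile1// ltW.
Qed.

Lemma qpoch_self_gt0 {R : realType} (q : R) (n : nat) :
  0 < q < 1 -> 0 < qpoch q q n.
Proof.
move=> /andP[q0 q1]; apply: prodr_gt0 => i _.
by rewrite subr_gt0 -exprS exprn_ilt1 ?ltW.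
Qed.

Lemma is_cvg_qpoch {R : realType} (q x : R) :
  0 < q < 1 -> 0 <= x <= 1 -> cvgn (qpoch x q).
Proof.
move=> q01 x01; apply: nonincreasing_is_cvgn; last first.
  by exists 0 => _ [n _ <-]; exact: qpoch_ge0.
apply/nonincreasing_seqP => n; rewrite /qpoch big_nat_recr//=.
rewrite ler_piMr ?qpoch_ge0// gerBl.
by case/andP: q01 => /ltW q0 _; case/andP: x01 => x0 _; rewrite mulr_ge0 ?exprn_ge0.
Qed.

Lemma qdilog0 {R : realType} (m : nat) (q : R) :
  0 < q < 1 -> (2 <= m)%N -> qdilog m q 0 = 0.
Proof.
move=> q01 m2; have zs := weight_submultiplicative m q q01 m2.
have zg := geo_decay_submultiplicative _ zs.
by rewrite /dilog psum_log_coef0//; apply/geo_decay_shift/geo_decay_log_coef.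
Qed.

Lemma weight_scale_gt0 {R : realType} (m : nat) (q : R) :
  0 < q < 1 -> (2 <= m)%N -> 0 < weight_scale m q.
Proof.
case: m => [|[|m]]// q01 _.
by rewrite mulr_gt0 ?divr_gt0 ?ltr0n// oppr_gt0 ln_lt0.
Qed.

Lemma qpoch_nonmultiples {R : realType} (m : nat) (q x : R) (N : nat) :
  0 < q < 1 -> (2 <= m)%N -> 0 <= x <= 1 ->
  \prod_(0 <= i < N) \prod_(1 <= r < m) (1 - x * q ^+ (m * i + r)) =
  expR ((qdilog m q (x * q ^+ (m * N)) - qdilog m q x) / weight_scale m q).
Proof.
move=> q01 m2 x01; have [-> P0] := qdilog_prod m q x N q01 m2 x01.
by rewrite mulrC mulKf ?lnK// gt_eqF// weight_scale_gt0.
Qed.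

(** Limit of the finite splitting along the indices m N: x Q^N tends to 0, and P is continuous there
    with P(0) = 0. *)
Lemma qpoch_inf_split {R : realType} (m : nat) (q x : R) :
  0 < q < 1 -> (2 <= m)%N -> 0 <= x <= 1 ->
  qpoch_inf x q =
  qpoch_inf x (q ^+ m) * expR (- qdilog m q x / weight_scale m q).
Proof.
move=> q01 m2 x01; have /andP[q0 q1] := q01.
have m0 : (0 < m)%N by exact: ltnW.
have Q01 : 0 < q ^+ m < 1 by rewrite exprn_gt0// exprn_ilt1 ?(ltW q0)// -lt0n.
have zg := geo_decay_submultiplicative _ (weight_submultiplicative m q q01 m2).
have cQ := is_cvg_qpoch _ _ Q01 x01; have cq := is_cvg_qpoch _ _ q01 x01.
have c0 : x * (q ^+ m) ^+ N @[N --> \oo] --> (0 : R).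
  apply: (@cvg_geometric R x (q ^+ m)).
  by case/andP: Q01 => ? ?; rewrite ger0_norm// ltW.
have cP : qdilog m q (x * (q ^+ m) ^+ N) @[N --> \oo] --> qdilog m q 0.
  have dg := geo_decay_log_coef _ (geo_decay_shift _ (geo_decay_log_coef _ zg)).
  have [|d _] := is_derive_psum _ 0 dg; first by rewrite normr0.
  apply: (cvg_comp _ _ c0).
  by apply: differentiable_continuous; apply/derivable1_diffP.
have cE :
    expR ((qdilog m q (x * (q ^+ m) ^+ N) - qdilog m q x) / weight_scale m q)
    @[N --> \oo] --> expR (- qdilog m q x / weight_scale m q).
  apply: continuous_cvg; first exact: continuous_expR.
  apply: cvgM; last exact: cvg_cst.
  by have := cvgB cP (cvg_cst (qdilog m q x)); rewrite qdilog0// sub0r; apply.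
have cR : qpoch x (q ^+ m) N *
    expR ((qdilog m q (x * (q ^+ m) ^+ N) - qdilog m q x) / weight_scale m q)
    @[N --> \oo] --> qpoch_inf x (q ^+ m) * expR (- qdilog m q x / weight_scale m q).
  exact: cvgM.
have cL : qpoch x q (m * N) @[N --> \oo] --> qpoch_inf x q.
  exact: (cvg_comp _ _ (cvg_mulnl _ m0) cq).
rewrite -(cvg_lim _ cL)// -[RHS](cvg_lim _ cR)//; congr (limn _).
by apply/funext => N; rewrite qpoch_split// qpoch_nonmultiples// exprM.
Qed.

(** * Reduction to the dilogarithm inequality *)

Theorem theorem1p3 (R : realType) (q : R) (m : nat)
    (hq0 : 0 < q) (hq1 : q < 1) (hm : (2 <= m)%N)
    (x : R) (hx0 : 0 <= x) (hx1 : x <= 1) (k : nat) :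
  qp (m * k)%N q x <= qp k (q ^+ m) x.
Proof.
have q01 : 0 < q < 1 by rewrite hq0.
have x01 : 0 <= x <= 1 by rewrite hx0.
have m0 : (0 < m)%N by exact: ltnW.
have Q01 : 0 < q ^+ m < 1 by rewrite exprn_gt0// exprn_ilt1 ?(ltW hq0)// -lt0n.
have one01 : 0 <= (1 : R) <= 1 by rewrite ler01 lexx.
have zs := weight_submultiplicative m q q01 hm.
have K0 := weight_scale_gt0 m q q01 hm.
rewrite /qp qpoch_self_split// (qpoch_nonmultiples _ _ _ _ q01 hm one01) mul1r.
rewrite (qpoch_inf_split _ _ _ q01 hm x01).
have := qpoch_self_gt0 _ k Q01; move: (qpoch (q ^+ m) (q ^+ m) k) => J J0.
have : 0 <= qpoch_inf x (q ^+ m).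
  by apply: limr_ge; [exact: is_cvg_qpoch|apply: nearW => n; exact: qpoch_ge0].
move: (qpoch_inf x _) => I I0.
set E1 := expR _; set E2 := expR _.
have E20 : 0 < E2 by exact: expR_gt0.
(* The factor I / J is common to both sides, with E1 = exp(- P(x) / kappa) and E2 = exp((P(Q^k) -
   P(1)) / kappa). *)
rewrite (_ : _ / _ = I / J * (x ^+ (m * k) * E1 / E2));
  last by field; rewrite !gt_eqF.
rewrite (_ : x ^+ k * I / J = I / J * x ^+ k); last by ring.
apply: ler_wpM2l; first by rewrite divr_ge0// ltW.
rewrite ler_pdivrMr//.
have [x0|x0] := eqVneq x 0.
  (* At x = 0 no logarithm is available: both sides are 0 for k > 0 and 1 for k = 0. *)
  case: k @E2 E20 => [|k] E2 E20; last first.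
    by rewrite x0 !expr0n muln_eq0 (gtn_eqF m0)/= !mul0r.
  rewrite /E1 /E2 muln0 !expr0 subrr mul0r expR0 !mul1r x0 qdilog0//.
  by rewrite oppr0 mul0r expR0.
have {x0} x0 : 0 < x by rewrite lt_neqAle eq_sym x0.
have xp n : x ^+ n = expR (n%:R * ln x) by rewrite expRM_natl lnK.
rewrite !xp -!expRD ler_expR.
have y01 : 0 < q ^+ (m * k) <= 1 by rewrite exprn_gt0//= exprn_ile1 ?ltW.
have x01' : 0 < x <= 1 by rewrite x0.
have := dilog_ineq _ _ _ zs x01' y01.
rewrite lnXn// -[ln q *+ _]mulr_natl !natrM.
move: (qdilog m q x) (qdilog m q (q ^+ (m * k))) (qdilog m q 1) => Px Py P1 H.
rewrite -(ler_pM2r K0) !mulrDl !divfK ?gt_eqF//.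
(* The choice of kappa turns kappa (k - m k) ln x into ln x ln y with y = q^(m k). *)
rewrite -subr_ge0 (_ : _ - _ = ln x * (m%:R * k%:R * ln q) + Px + Py - P1).
  by rewrite subr_ge0.
rewrite /weight_scale; case: m m0 hm {H zs K0 Q01 E20 E1 E2 y01} => [|[|n]]// _ _ /=.
rewrite -[n.+2%:R]natr1; have : n.+1%:R != 0 :> R by rewrite pnatr_eq0.
by move: (n.+1%:R) => a a0; field.
Qed.
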